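(* For every integer $n\geq 2$ there exists a constant $C_n$, depending only on $n$, such that the following holds. Let $\mathbb{F}$ be any field, let $\mathfrak{L}$ be a finite collection of $L$ lines in $\mathbb{F}^n$, and let $J$ be the set of joints formed by $\mathfrak{L}$. Then $$|J|\leq C_n\cdot L^{\frac{n}{n-1}}.$$
   Context: A collection of lines is a set of distinct lines. A line in $\mathbb{F}^n$ is a set $\{v+tb : t\in\mathbb{F}\}$ with $v,b\in\mathbb{F}^n$, $b\neq 0$; $b$ is its direction. A joint formed by a finite collection $\mathfrak{L}$ of lines in $\mathbb{F}^n$ is a point of $\mathbb{F}^n$ that lies in the intersection of at least $n$ lines of $\mathfrak{L}$ whose directions span $\mathbb{F}^n$. *)

(* Defs.v *)
From mathcomp Require Export all_boot all_order all_algebra.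
From mathcomp Require Export finmap.
From mathcomp Require Export boolp classical_sets functions cardinality.
From mathcomp Require Export reals exp.

Set Implicit Arguments.
Unset Strict Implicit.
Unset Printing Implicit Defensive.

Import Order.TTheory GRing.Theory Num.Theory.
Local Open Scope classical_set_scope.
Local Open Scope ring_scope.

Definition line (F : fieldType) (n : nat) (v b : 'rV[F]_n) : set 'rV[F]_n :=
  [set v + t *: b | t in [set: F]].

(* A line determines its direction only up to a nonzero scalar, so being a
   direction is a relation. *)
Definition is_direction (F : fieldType) (n : nat) (l : set 'rV[F]_n)
    (b : 'rV[F]_n) : Prop :=
  b != 0 /\ exists v : 'rV[F]_n, l = line v b.

Definition is_line (F : fieldType) (n : nat) (l : set 'rV[F]_n) : Prop :=
  exists b : 'rV[F]_n, is_direction l b.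

(* [d] picks one direction of each line of [S]; the span of these vectors does
   not depend on the choice. *)
Definition directions_span (F : fieldType) (n : nat)
    (S : {fset (set 'rV[F]_n)}) : Prop :=
  exists d : set 'rV[F]_n -> 'rV[F]_n,
    (forall l, l \in S -> is_direction l (d l)) /\
    <<[seq d l | l <- enum_fset S]>>%VS = fullv.

Definition joints (F : fieldType) (n : nat) (LL : {fset (set 'rV[F]_n)}) :
    set 'rV[F]_n :=
  [set x | exists S : {fset (set 'rV[F]_n)},
    [/\ (S `<=` LL)%fset, (n <= #|` S|)%N,
        forall l, l \in S -> l x & directions_span S]].

(* Main.v *)
Require Import Defs.
From mathcomp Require Import zify.
From mathcomp Require mpoly.

(* The polynomial method. For a nonempty set J of fewer than (d+1)^n joints,
   take a nonzero polynomial of degree at most nd vanishing on J. Lowering its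
   degree as long as possible makes its gradient nonzero at some joint:
   otherwise a partial derivative has smaller degree, or all partial
   derivatives are zero and, in characteristic q, a q-th root can be
   extracted. If every line contained more than nd points of J, the polynomial
   would vanish on every line, so its directional derivatives at that joint,
   hence its gradient, would be zero. So some line contains at most nd points
   of J; removing it with these points and iterating gives |J| <= n d L, and d
   = floor(|J|^(1/n)) concludes. *)

Set Implicit Arguments.
Unset Strict Implicit.
Unset Printing Implicit Defensive.

Import -(notations) mpoly.
Import Order.TTheory GRing.Theory Num.Theory.
Local Open Scope classical_set_scope.
Local Open Scope ring_scope.

Local Notation "p ^`M ( i )" := (mderiv i p).
Local Notation msize := (mmeasure mdeg).

(** * Restriction of a polynomial to a line *)

Section Restriction.
Variables (F : fieldType) (n : nat).
Implicit Types (p : mpoly n F) (x b : 'rV[F]_n) (m : multinom n).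

Definition line_poly x b (i : 'I_n) : {poly F} := (x 0 i)%:P + b 0 i *: 'X.

(** Kept as a formal polynomial in the parameter of the line: over a finite field, a function
    vanishing on the whole line would not force the derivative below to vanish. *)
Definition restrict x b p : {poly F} := mmap polyC (line_poly x b) p.

Lemma horner_restrict x b p t :
  (restrict x b p).[t] = meval ((x + t *: b) 0) p.
Proof.
rewrite /restrict mevalE /mmap horner_sum; apply: eq_bigr => m _.
rewrite hornerM hornerC /mmap1 horner_prod; congr (_ * _).
apply: eq_bigr => i _.
by rewrite horner_exp hornerD hornerC hornerZ hornerX !mxE mulrC.
Qed.

Lemma size_restrict x b p : (size (restrict x b p) <= msize p)%N.
Proof.
apply: leq_trans (size_sum _ _ _) _; apply/bigmax_leqP_seq => m mp _.
apply: leq_trans (msize_mdeg_lt mp); rewrite mul_polyC.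
apply: leq_trans (size_scale_leq _ _) _.
rewrite /mmap1 mdegE.
(* Each factor [line_poly x b i] has degree at most 1, and degree bounds add under products, so a
   monomial of degree k restricts to degree at most k. *)
pose K (q : {poly F}) k := (size q <= k.+1)%N.
have KM q1 q2 k1 k2 : K q1 k1 -> K q2 k2 -> K (q1 * q2) (k1 + k2)%N.
  by rewrite /K => h1 h2; apply: leq_trans (size_polyMleq _ _) _; lia.
apply: (big_ind2 K) => [|??????|i _]; [by rewrite /K size_poly1|exact: KM|].
elim: (m i) => [|k IH]; first by rewrite /K expr0 size_poly1.
rewrite exprS -add1n; apply: KM => //.
rewrite /K (leq_trans (size_polyD _ _))// geq_max.
rewrite (leq_trans (size_polyC_leq1 _))//.
by rewrite (leq_trans (size_scale_leq _ _))// size_polyX.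
Qed.

(** The chain rule. Both sides are additive and obey the Leibniz rule, so constants and variables
    suffice. *)
Lemma deriv_restrict x b p :
  (restrict x b p)^`() = \sum_(i < n) b 0 i *: restrict x b (p^`M(i)).
Proof.
pose P p := (restrict x b p)^`() = \sum_(i < n) b 0 i *: restrict x b (p^`M(i)).
have PD q r : P q -> P r -> P (q + r).
  rewrite /P /restrict mmapD derivD => -> ->; rewrite -big_split/=.
  by apply: eq_bigr => i _; rewrite mderivD mmapD scalerDr.
have PM q r : P q -> P r -> P (q * r).
  rewrite /P /restrict rmorphM derivM => -> ->.
  rewrite mulr_suml mulr_sumr -big_split/=; apply: eq_bigr => i _.
  by rewrite mderivM mmapD !rmorphM/= scalerDr scalerAl scalerAr.
have PC c : P (mpolyC n c).
  rewrite /P /restrict mmapC derivC big1// => i _.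
  by rewrite mderivC mmap0 scaler0.
have PX i : P (mpolyX F (mnm1 i)).
  rewrite /P /restrict mmapX mmap1U derivD derivC derivZ derivX add0r.
  rewrite (bigD1 i)//= big1 => [|j ji]; rewrite mderivX mnmE.
    rewrite eqxx scale1r addr0 mmapX/= /mmap1 big1// => j _.
    by rewrite mnmE mnm1E subnn.
  by rewrite eq_sym (negPf ji) scale0r mmap0 scaler0.
rewrite -/(P p) (mpolyE p); apply: (big_ind P) => [||m _]; [|exact: PD|].
  by rewrite -mpolyC0.
rewrite -mul_mpolyC; apply: (PM) => //; rewrite mpolyXE_id.
apply: (big_ind P) => [||i _]; [|exact: PM|].
  by rewrite -mpolyC1.
elim: (m i) => [|k IH]; first by rewrite expr0 -mpolyC1.
by rewrite exprS; apply: PM.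
Qed.

End Restriction.

(** * Low-degree polynomials vanishing on a finite set, and their gradients *)

Definition vanishes (F : fieldType) (n : nat) (J : set 'rV[F]_n)
    (p : mpoly n F) : Prop :=
  forall x, J x -> meval (x 0) p = 0.

Section Vanishing.
Variables (F : fieldType) (n : nat).
Implicit Types (p : mpoly n F) (J : set 'rV[F]_n).

(** The (d+1)^n monomials with every exponent at most d outnumber the points, so the evaluation
    matrix has a nonzero left kernel vector. [msize] is the degree plus one. *)
Lemma exists_vanishing (J : {fset 'rV[F]_n}) d : (#|` J| < d.+1 ^ n)%N ->
  exists p, [/\ p != 0, (msize p <= (n * d).+1)%N & vanishes [set` J] p].
Proof.
move=> Jd.
pose T := {ffun 'I_n -> 'I_d.+1}.
have cT : #|T| = (d.+1 ^ n)%N by rewrite card_ffun !card_ord.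
pose mon (k : 'I_#|T|) : multinom n :=
  Multinom [tuple (enum_val k i : nat) | i < n].
have monE k i : mon k i = enum_val k i by rewrite /mon mnm_tnth tnth_mktuple.
have mon_inj : injective mon.
  move=> k1 k2 /mnmP e; apply: enum_val_inj; apply/ffunP => i; apply/val_inj.
  by have := e i; rewrite !monE.
pose A := \matrix_(k < #|T|, j < #|` J|)
  meval ((J`_j : 'rV[F]_n) 0) (mpolyX F (mon k)).
pose v := nz_row (kermx A).
have v0 : v != 0.
  rewrite nz_row_eq0 -mxrank_eq0 mxrank_ker subn_eq0 -ltnNge.
  by rewrite (leq_ltn_trans (rank_leq_col A))// cT.
have vA : v *m A = 0 by apply/sub_kermxP/nz_row_sub.
exists (\sum_k v 0 k *: mpolyX F (mon k)); split.
- apply: contra v0 => /eqP p0; apply/eqP/rowP => k; rewrite mxE.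
  have := congr1 (mcoeff (mon k)) p0.
  rewrite raddf_sum/= (bigD1 k)//= mcoeffZ mcoeffX eqxx mulr1.
  rewrite big1 => [|j jk]; first by rewrite addr0 mcoeff0.
  by rewrite mcoeffZ mcoeffX (inj_eq mon_inj) (negPf jk) mulr0.
- apply: leq_trans (msize_sum _ _ _) _; apply/bigmax_leqP => k _.
  apply: leq_trans (msizeZ_le _ _) _.
  rewrite msizeX ltnS mdegE -[X in (_ <= X * _)%N](card_ord n) -sum_nat_const.
  by apply: leq_sum => i _; rewrite monE -ltnS.
- move=> x /= xJ; have xJ' : (index x J < #|` J|)%N by rewrite index_mem.
  have /rowP/(_ (Ordinal xJ')) := vA; rewrite !mxE => e.
  rewrite raddf_sum/= -[RHS]e; apply: eq_bigr => k _.
  by rewrite mevalZ !mxE/= nth_index.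
Qed.

(* Over an imperfect field [p] need not be a [q]-th power; instead, a point of
   [J] where some [u.2] does not vanish yields a linear relation between the
   coefficients [u.1] over the field of [q]-th powers, which shortens the
   sum. *)
Lemma pchar_vanishing_root J q (s : seq (F * mpoly n F)) k : q \in [pchar F] ->
  (forall u, u \in s -> (msize u.2 <= k)%N) ->
  let p := \sum_(u <- s) u.1 *: u.2 ^+ q in
  p != 0 -> vanishes J p ->
  exists r, [/\ r != 0, (msize r <= k)%N & vanishes J r].
Proof.
move=> qF; have [l] := ubnP (size s); elim: l s => // l IH s sl sk p p0 pJ.
have q0 : (0 < q)%N by rewrite prime_gt0 // (pcharf_prime qF).
have [all_vanish|] := pselect (forall u, u \in s -> vanishes J u.2).
  have [[u us u0]|none] := pselect (exists2 u, u \in s & u.2 != 0).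
    by exists u.2; split; [|exact: sk|exact: all_vanish].
  case/negP: p0; apply/eqP; rewrite /p big_seq big1// => u us.
  have [->|u0] := eqVneq u.2 0; first by rewrite expr0n gtn_eqF// scaler0.
  by case: none; exists u.
move=> /existsNP[u /not_implyP[us /existsNP[x /not_implyP[Jx /eqP ux]]]].
pose c (w : F * mpoly n F) := meval (x 0) w.2 / meval (x 0) u.2.
pose s' := [seq (w.1, w.2 - c w *: u.2) | w <- rem u s].
have qM : q \in [pchar (mpoly n F)].
  apply/andP; split; first exact: pcharf_prime qF.
  by rewrite -mpolyC_nat (pcharf0 qF) mpolyC0.
(* Evaluating p at x expresses [u.1] as minus the sum of the [w.1 * c w ^+ q]. As q-th powers are
   additive, the corrections by [u.2] make up for the dropped term. *)
have ps' : \sum_(w <- s') w.1 *: w.2 ^+ q = p.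
  rewrite big_map/=.
  under eq_bigr do rewrite exprDn_pchar ?pnatE ?(pcharf_prime qF)//
    exprNn_pchar ?pnatE ?(pcharf_prime qF)// exprZn scalerBr scalerA.
  rewrite sumrB -scaler_suml /p (perm_big _ (perm_to_rem us)) big_cons/= addrC.
  congr (_ + _).
  rewrite -scaleNr; congr (_ *: _).
  have := pJ x Jx; rewrite /p (perm_big _ (perm_to_rem us)) big_cons/=.
  rewrite mevalD mevalZ rmorphXn/= => /eqP; rewrite addr_eq0 => /eqP e.
  apply: (mulIf (expf_neq0 q ux)); rewrite e mulNr; congr (- _).
  rewrite raddf_sum/= mulr_suml; apply: eq_bigr => w _.
  by rewrite mevalZ rmorphXn/= -mulrA -exprMn divfK.
apply: (IH s'); rewrite ?ps'//.
  rewrite size_map size_rem//; case: s us sl {sk p p0 pJ s' ps'} => //=.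
move=> _ /mapP[w /mem_rem ws ->] /=.
apply: leq_trans (msizeD_le _ _) _; rewrite geq_max sk// msizeN.
by apply: leq_trans (msizeZ_le _ _) _; exact: sk.
Qed.

Lemma msize_mderiv i p : p^`M(i) != 0 -> (msize p^`M(i) < msize p)%N.
Proof.
move=> d0; rewrite -(mlead_deg d0).
have : mlead p^`M(i) \in msupp p^`M(i) by exact: mlead_supp.
rewrite mcoeff_msupp mcoeff_mderiv => c0.
have : mnm_add (mlead p^`M(i)) (mnm1 i) \in msupp p.
  by rewrite mcoeff_msupp; apply: contraNneq c0 => ->; rewrite mul0rn.
by move=> /msize_mdeg_lt; rewrite mdegD mdeg1 addn1.
Qed.

Lemma exists_vanishing_nonsingular J p : J !=set0 -> p != 0 -> vanishes J p ->
  exists r, [/\ vanishes J r, (msize r <= msize p)%N &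
    exists x i, J x /\ meval (x 0) r^`M(i) != 0].
Proof.
move=> J0; have [l] := ubnP (msize p); elim: l p => // l IH p pl p0 pJ.
apply: contrapT => none.
(* By induction, p may be treated as having minimal degree among the nonzero polynomials vanishing
   on J. *)
have lower r : r != 0 -> vanishes J r -> (msize r < msize p)%N -> False.
  move=> r0 rJ rp; have [|t [tJ tr tx]] := IH r _ r0 rJ.
    exact: leq_trans rp _.
  by apply: none; exists t; split => //; apply: leq_trans tr (ltnW rp).
have d0 i : p^`M(i) = 0.
  apply/eqP/negPn/negP => d0; apply: (lower _ d0); last exact: msize_mderiv.
  move=> x Jx; apply: contrapT => /eqP dx; apply: none.
  by exists p; split=> //; exists x, i.
(* All partial derivatives vanish, so every exponent occurring in p is zero in F. *)
have suppE m i : m \in msupp p -> (m i)%:R = 0 :> F.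
  move=> mp; have [->//|mi0] := posnP (m i).
  have := congr1 (mcoeff (mnm_sub m (mnm1 i))) (d0 i).
  rewrite mcoeff_mderiv mcoeff0 submK; last first.
    by apply/mnm_lepP => j; rewrite mnm1E; case: eqP => // <-.
  rewrite mnmBE mnm1E eqxx subn1 prednK// -[mcoeff _ _ *+ _]mulr_natr => /eqP.
  by rewrite mulf_eq0 mcoeff_eq0 mp/= => /eqP.
have size_p : (1 < msize p)%N.
  rewrite ltnNge; apply/negP => /msize1_polyC pE.
  have [x Jx] := J0; have := pJ x Jx; rewrite pE mevalC => c0.
  by move: p0; rewrite pE c0 mpolyC0 eqxx.
have [m mp mE] : exists2 m, m \in msupp p & (0 < mdeg m)%N.
  exists (mlead p); first exact: mlead_supp.
  by rewrite -ltnS mlead_deg.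
have [i mi] : exists i, (0 < m i)%N.
  apply: contrapT => /forallNP h; move: mE; rewrite mdegE big1// => i _.
  by apply/eqP; rewrite -leqn0 leqNgt; apply/negP.
have /eqP mi0 := suppE m i mp.
have [q qF] := natf0_pchar mi mi0.
have q1 : (1 < q)%N by rewrite prime_gt1// (pcharf_prime qF).
pose root m : multinom n := Multinom [tuple (m i %/ q)%N | i < n].
have rootE m' j : root m' j = (m' j %/ q)%N.
  by rewrite /root mnm_tnth tnth_mktuple.
have rootK m' : m' \in msupp p -> m' = mnm_muln (root m') q.
  move=> m'p; apply/mnmP => j; rewrite mulmnE rootE divnK//.
  by rewrite (dvdn_pcharf qF) suppE.
(* Only the monomials are q-th powers; the coefficients need not be. *)
pose s := [seq (mcoeff m p, mpolyX F (root m)) | m <- msupp p].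
have pE : \sum_(u <- s) u.1 *: u.2 ^+ q = p.
  rewrite big_map [RHS]mpolyE big_seq [RHS]big_seq; apply: eq_bigr => m' m'p /=.
  by rewrite mpolyXn -rootK.
have [|||r [r0 rs rJ]] := @pchar_vanishing_root J q s (msize p).-1 qF.
- move=> _ /mapP[m' m'p ->] /=; rewrite msizeX.
  have := msize_mdeg_lt m'p; rewrite {1}(rootK m' m'p).
  have -> : mdeg (mnm_muln (root m') q) = (mdeg (root m') * q)%N.
    by rewrite !mdegE big_distrl/=; apply: eq_bigr => j _; rewrite mulmnE.
  (* As q >= 2, division by q lowers a positive degree; for a root monomial of degree 0, [size_p]
     gives the drop. *)
  nia.
- by rewrite pE.
- by rewrite pE.
- by apply: (lower r r0 rJ); lia.
Qed.

End Vanishing.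

(** * Lines with few joints, and their successive removal *)

Section Joints.
Variables (F : fieldType) (n : nat).
Implicit Types (x b g : 'rV[F]_n) (J : {fset 'rV[F]_n}).
Implicit Types (l : set 'rV[F]_n) (LL : {fset (set 'rV[F]_n)}).

Lemma restrict_eq0 J l x b (p : mpoly n F) :
  is_direction l b -> l x -> vanishes [set` J] p ->
  (msize p <= #|` [fset y in J | `[< l y >] ]%fset|)%N -> restrict x b p = 0.
Proof.
move=> [b0 [v lE]] lx pJ hcard; apply/eqP/negPn/negP => r0.
(* Distinct points of l have distinct parameters, hence give distinct roots; the value 0 off l is a
   dummy. *)
have /choice[t tP] : forall y, exists t, l y -> y = x + t *: b.
  move=> y; have [|nly] := pselect (l y); last by exists 0.
  move: lx; rewrite lE => -[s _ <-] [s' _ <-]; exists (s' - s) => _.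
  by rewrite -addrA -scalerDl [s + _]addrC subrK.
set Jl := [fset _ in J | _]%fset in hcard.
have JlP y : y \in Jl -> y \in J /\ y = x + t y *: b.
  by rewrite !inE/= => /andP[yJ /asboolP ly]; split=> //; exact: tP.
have : (size [seq t y | y <- enum_fset Jl] < size (restrict x b p))%N.
  apply: max_poly_roots r0 _ _.
    apply/allP => _ /mapP[y /JlP[yJ yE] ->].
    by rewrite /root horner_restrict -yE pJ.
  rewrite map_inj_in_uniq ?fset_uniq// => y z /JlP[_ yE] /JlP[_ zE] e.
  by rewrite yE zE e.
rewrite size_map ltnNge => /negP; apply.
exact: leq_trans (size_restrict x b p) hcard.
Qed.

(** Used with g the gradient at a joint. The entries of g are its dot products with the standard
    basis vectors, which are combinations of s. *)
Lemma dot_span_eq0 (s : seq 'rV[F]_n) g :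
  <<s>>%VS = fullv -> (forall b, b \in s -> \sum_(i < n) b 0 i * g 0 i = 0) ->
  g = 0.
Proof.
move=> s_full gs; apply/rowP => i; rewrite mxE.
pose f b := \sum_(i < n) b 0 i * g 0 i.
have : delta_mx 0 i \in <<in_tuple s>>%VS by rewrite s_full memvf.
move=> /coord_span e.
transitivity (f (delta_mx 0 i)).
  rewrite /f (bigD1 i)//= mxE !eqxx mul1r big1 ?addr0// => j ji.
  by rewrite mxE (negPf ji) andbF mul0r.
rewrite e /f; under eq_bigr do rewrite summxE mulr_suml.
rewrite exchange_big big1// => k _ /=.
under eq_bigr do rewrite mxE -mulrA.
by rewrite -mulr_sumr gs ?mulr0// mem_nth.
Qed.

Lemma exists_sparse_line J LL d : J != fset0 -> [set` J] `<=` joints LL ->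
  (#|` J| < d.+1 ^ n)%N ->
  exists2 l, l \in LL & (#|` [fset y in J | `[< l y >] ]%fset| <= n * d)%N.
Proof.
move=> J0 JLL Jd; apply: contrapT => none.
have [p [p0 p_le pJ]] := exists_vanishing Jd.
have J0' : [set` J] !=set0 by have [x xJ] := fset0Pn _ J0; exists x.
have [r [rJ rp [x [i [xJ]]]]] := exists_vanishing_nonsingular J0' p0 pJ.
move=> /eqP; apply.
have [S [/fsubsetP SLL _ Sx [b [bS b_span]]]] := JLL x xJ.
have /(dot_span_eq0 b_span)/rowP/(_ i) :
  forall c, c \in [seq b l | l <- enum_fset S] ->
    \sum_(i < n) c 0 i * (\row_j meval (x 0) r^`M(j)) 0 i = 0.
  move=> _ /mapP[l lS ->].
  (* More than n d points on the line means at least [msize r] of them, one more than the degree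
     allows. *)
  have r_eq0 : restrict x (b l) r = 0.
    apply: (restrict_eq0 (bS l lS) (Sx l lS) rJ); rewrite leqNgt.
    apply/negP => few; apply: none; exists l; first exact: SLL.
    by rewrite -ltnS (leq_trans few)// (leq_trans rp).
  (* At parameter 0 the chain rule gives the directional derivative of r at x. *)
  have := congr1 (fun q => q.[0]) (deriv_restrict x (b l) r).
  rewrite r_eq0 deriv0 horner0 horner_sum => e; rewrite [RHS]e.
  apply: eq_bigr => j _.
  by rewrite mxE hornerZ horner_restrict scale0r addr0.
by rewrite !mxE.
Qed.

(** Induction on the number of lines, each removal costing at most n d points. The same d serves
    throughout because J only shrinks. *)
Lemma card_joints_le J LL d : [set` J] `<=` joints LL ->
  (#|` J| < d.+1 ^ n)%N -> (#|` J| <= n * d * #|` LL|)%N.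
Proof.
have [k] := ubnP #|` LL|; elim: k J LL => // k IH J LL LLk JLL Jd.
have [->|J0] := eqVneq J fset0; first by rewrite cardfs0.
have [l lLL l_sparse] := exists_sparse_line J0 JLL Jd.
rewrite (cardfsD1 l) lLL in LLk *.
set Jl := [fset _ in J | _]%fset in l_sparse.
have JlJ : (Jl `<=` J)%fset by apply: fset_sub.
rewrite -(cardfsID Jl J) mulnDr muln1 leq_add//.
  by rewrite (leq_trans _ l_sparse)// fsubset_leq_card// fsubsetIr.
apply: IH => //; last first.
  by apply: leq_ltn_trans Jd; rewrite fsubset_leq_card// fsubsetDl.
move=> x /=; rewrite !inE/= => /andP[xl xJ].
(* A point off l remains a joint without l: the lines witnessing it pass through it, so l is not
   among them. *)
have [S [SLL Sn Sx Sspan]] := JLL x xJ; exists S; split=> //.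
rewrite fsubsetD1 SLL/=; apply: contra xl => lS.
by rewrite xJ; apply/asboolP; exact: Sx.
Qed.

End Joints.

(** * From the linear bound to the exponent n/(n-1), and finiteness *)

Lemma card_joints_powR (R : realType) (n : nat) (F : fieldType)
    (J : {fset 'rV[F]_n}) (LL : {fset (set 'rV[F]_n)}) :
  (2 <= n)%N -> [set` J] `<=` joints LL ->
  (#|` J|%:R : R) <=
    n%:R `^ (n%:R / (n%:R - 1)) * #|` LL|%:R `^ (n%:R / (n%:R - 1)).
Proof.
move=> n2 JLL; set N := #|` J|; set L := #|` LL|.
have [->|N_gt0] := posnP N; first by rewrite mulr_ge0 ?powR_ge0.
have n_gt1 : 1 < n%:R :> R by rewrite ltr1n.
have n_gt0 : 0 < n%:R :> R by rewrite ltr0n ltnW.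
have nm1_gt0 : 0 < n%:R - 1 :> R by rewrite subr_gt0.
pose y : R := N%:R `^ n%:R^-1.
have y_gt0 : 0 < y by rewrite powR_gt0 ?ltr0n.
have yn : y ^+ n = N%:R.
  by rewrite -powR_mulrn ?ltW// -powRrM mulVf ?gt_eqF// powRr1.
pose d := Num.truncn y.
have /andP[dy yd] : d%:R <= y < d.+1%:R by apply: truncn_itv; exact: ltW.
have Nd : (N < d.+1 ^ n)%N.
  by rewrite -(ltr_nat R) natrX -yn ltrXn2r// ?ltW//; lia.
have NL : N%:R <= n%:R * y * L%:R :> R.
  apply: le_trans (_ : (n * d * L)%:R <= _).
    by rewrite ler_nat; exact: card_joints_le.
  by rewrite !natrM ler_wpM2r// ler_wpM2l.
(* Since N = y^n, one factor y cancels from N <= n y L. *)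
have yL : y `^ (n%:R - 1) <= n%:R * L%:R.
  rewrite -(ler_pM2l y_gt0) mulr_powRB1 ?(ltW y_gt0)//.
  by rewrite powR_mulrn ?(ltW y_gt0)// yn mulrCA mulrA.
have e_ge0 : 0 <= n%:R / (n%:R - 1) :> R by rewrite divr_ge0 ?ltW.
rewrite -powRM//.
(* Raising to the power n/(n-1) turns the left side back into y^n = N and produces the constant
   n^(n/(n-1)). *)
apply: le_trans (_ : (y `^ (n%:R - 1)) `^ (n%:R / (n%:R - 1)) <= _).
  rewrite -powRrM mulrCA divff ?gt_eqF// mulr1 powR_mulrn ?(ltW y_gt0)//.
  by rewrite yn.
by apply: ge0_ler_powR => //; rewrite nnegrE ?powR_ge0// mulr_ge0.
Qed.

Theorem theorem7p0p1 (R : realType) (n : nat) (hn : (2 <= n)%N) :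
  exists C : R,
    forall (F : fieldType) (LL : {fset (set 'rV[F]_n)}),
      (forall l : set 'rV[F]_n, l \in LL -> is_line l) ->
      finite_set (joints LL) /\
      (#|` fset_set (joints LL)|%:R : R) <=
        C * (#|` LL|%:R : R) `^ (n%:R / (n%:R - 1)).
Proof.
exists (n%:R `^ (n%:R / (n%:R - 1))) => F LL _.
(* An infinite set of joints would have a finite subset larger than the bound. Finiteness matters
   because [fset_set] of an infinite set defaults to the empty set. *)
have fin : finite_set (joints LL).
  apply: contrapT => /infinite_set_fset inf.
  have [J /(card_joints_powR R hn) JLL] := inf (Num.truncn
    ((n%:R : R) `^ (n%:R / (n%:R - 1)) * #|` LL|%:R `^ (n%:R / (n%:R - 1)))).+1.
  by rewrite truncn_lt_nat ?mulr_ge0 ?powR_ge0// ltNge JLL.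
split=> //; apply: card_joints_powR => //.
by rewrite fset_setK.
Qed.
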